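(* If $d\in\mathbb{N}$, then there exists a constant $c=c(d)>0$ so that for every $k\in\{1,\ldots,d\}$ and every measure $\mu$ on $\mathbb{R}^d$ we have $$\overline{\dim}_{\mathrm{loc}}(\mu,x)\le d-k+\frac{c}{-\log\bigl(1-2\operatorname{por}_k(\mu,x)\bigr)}$$ for $\mu$-almost all $x\in\mathbb{R}^d$.
   Context: A measure on $\mathbb{R}^d$ means a nontrivial Borel regular outer measure defined on all subsets of $\mathbb{R}^d$ such that bounded sets have finite measure. $B(x,r)$ is the closed ball. The upper local dimension is $\overline{\dim}_{\mathrm{loc}}(\mu,x)=\limsup_{r\downarrow0}\log\mu(B(x,r))/\log r$. For a measure $\mu$ on $\mathbb{R}^d$, $k\in\{1,\ldots,d\}$, $x\in\mathbb{R}^d$, $r>0$ and $\varepsilon>0$, let $\operatorname{por}_k(\mu,x,r,\varepsilon)$ be the supremum of all $\varrho\ge0$ for which there are $y_1,\ldots,y_k\in\mathbb{R}^d$ such that for every $i$: $\mu(B(y_i,\varrho r))\le\varepsilon\mu(B(x,r))$ and $\varrho r+|x-y_i|\le r$, and $(y_i-x)\cdot(y_j-x)=0$ if $j\ne i$. The $k$-porosity of $\mu$ at $x$ is $\operatorname{por}_k(\mu,x)=\lim_{\varepsilon\downarrow0}\liminf_{r\downarrow0}\operatorname{por}_k(\mu,x,r,\varepsilon)$. (It is known that $\operatorname{por}_k(\mu,x)\le\frac12$ for $\mu$-almost all $x$.) The right-hand side of the inequality is interpreted as $+\infty$ when $\operatorname{por}_k(\mu,x)=0$ and as $d-k$ when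 $\operatorname{por}_k(\mu,x)=\frac12$. *)

(* Defs.v *)
From mathcomp Require Export all_boot all_order all_algebra.
From mathcomp Require Export all_classical all_reals all_analysis.

Set Implicit Arguments.
Unset Strict Implicit.
Unset Printing Implicit Defensive.

Export Order.TTheory GRing.Theory Num.Theory.
Export numFieldNormedType.Exports.

Local Open Scope classical_set_scope.
Local Open Scope ring_scope.

(* The library norm and balls of 'rV[R]_d are those of the sup norm: they give
   the right topology (hence Borel sets) and bounded sets, but the metric
   notions below are Euclidean. *)
Definition dotp (R : realType) (d : nat) (u v : 'rV[R]_d) : R :=
  \sum_(i < d) u 0 i * v 0 i.

Definition enorm (R : realType) (d : nat) (u : 'rV[R]_d) : R :=
  Num.sqrt (dotp u u).

Definition eball (R : realType) (d : nat) (x : 'rV[R]_d) (r : R) :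
    set 'rV[R]_d :=
  [set y | enorm (y - x) <= r].

Definition borel (T : topologicalType) : set (set T) := <<s @open T >>.

Record is_measure (R : realType) (d : nat)
    (mu : {outer_measure set 'rV[R]_d -> \bar R}) : Prop := IsMeasure {
  measure_nontrivial : (0 < mu setT)%E;
  borel_caratheodory :
    forall B : set 'rV[R]_d, borel B -> mu.-caratheodory B;
  borel_hull :
    forall A : set 'rV[R]_d,
      exists B, [/\ borel B, A `<=` B & mu B = mu A];
  bounded_finite :
    forall A : set 'rV[R]_d, bounded_set A -> (mu A < +oo)%E }.

Definition almost_all (R : realType) (d : nat)
    (mu : {outer_measure set 'rV[R]_d -> \bar R}) (P : 'rV[R]_d -> Prop) :=
  mu [set x | ~ P x] = 0%E.

(* [lne 0 = -oo]; as [ln r < 0] for small [r], the quotient is [+oo] when the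
   balls around [x] are eventually null. *)
Definition upper_local_dim (R : realType) (d : nat)
    (mu : {outer_measure set 'rV[R]_d -> \bar R}) (x : 'rV[R]_d) : \bar R :=
  limf_esup (fun r : R => lne (mu (eball x r)) / (ln r)%:E)%E 0^'+.

Definition por_scale (R : realType) (d k : nat)
    (mu : {outer_measure set 'rV[R]_d -> \bar R})
    (x : 'rV[R]_d) (r eps : R) : \bar R :=
  ereal_sup [set rho%:E | rho in
    [set rho : R | 0 <= rho /\ exists y : 'I_k -> 'rV[R]_d,
      (forall i,
         (mu (eball (y i) (rho * r)) <= eps%:E * mu (eball x r))%E /\
         rho * r + enorm (x - y i) <= r) /\
      (forall i j, j != i -> dotp (y i - x) (y j - x) = 0)]].

(* The limit exists because [por_scale] is nondecreasing in [eps]. *)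
Definition porosity (R : realType) (d k : nat)
    (mu : {outer_measure set 'rV[R]_d -> \bar R}) (x : 'rV[R]_d) : \bar R :=
  lim (limf_einf (fun r : R => por_scale k mu x r eps) 0^'+
         @[eps --> (0 : R)^'+]).

(* In [\bar R], [0^-1 = +oo] and [+oo^-1 = 0], and [lne t = -oo] for [t <= 0].
   Hence, for [c > 0], this is [+oo] when [p = 0] and [d - k] when [p = 1/2]
   (also when [p > 1/2], which occurs only on a null set). *)
Definition dim_bound (R : realType) (d k : nat) (c : R) (p : \bar R) : \bar R :=
  ((d%:R - k%:R)%:E + c%:E / - lne (1 - 2%:E * p))%E.

(* Main.v *)
Require Import Defs.
From mathcomp Require Import all_boot all_order all_algebra.
From mathcomp Require Import all_classical all_reals all_analysis.
From mathcomp Require Import ring lra zify.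

(** Cut space into the grids of cubes of side [N ^- j], where [N = 2 ^ m], and
    let [x] have porosity greater than [(1 - 1 / N) / 2]. At every small scale
    [r = N ^- j], the point [x] then has [k] holes in orthogonal directions:
    balls of radius [(1 - 1 / N) r / 2] that touch [x] up to an error [r / N] and
    whose measure is at most [eps] times that of the ball [B(x, r)]. Seen from
    [x], such a hole is almost a half-space ([hole_halfspace]), so points that
    lie outside each other's holes and have nearly parallel hole directions are
    spread over an approximate Lipschitz graph of dimension [d - k]
    ([outside_holes_close]). Call a cube of level [j + 1] heavy if a neighborhood
    of it carries more than the proportion [eps] of the measure of a
    neighborhood of the parent cube. A heavy cube cannot be contained in a hole
    of measure proportion [eps]; hence among the [N ^ d] children of a cube, at
    most [C N ^ (d - k)] heavy ones contain points with holes, where [C] depends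
    on [d] only ([holes_card_le], [heavy_card_le]).

    The other children may be numerous, but each is light. To neglect them, the
    measures of the neighborhoods are raised to a small power [theta], and
    [eps ^ theta] is chosen to be [N ^ - d]: then the sum over the children
    of the [theta]-th powers is at most [2 C N ^ (d - k)] times the [theta]-th
    power of the parent ([thin_le]). Iterating, the set of points whose cube at
    level [j + n] carries measure at most [N ^ (- n s)] has measure at most a
    constant times [(N ^ (- s (1 - theta)) 2 C N ^ (d - k)) ^ n]. With
    [theta = 1 / (2 m)], this is summable as soon as [s = d - k + e / m] for a
    constant [e] depending on [d] only. By Borel-Cantelli, almost every point with
    holes at all small scales has upper local dimension at most
    [d - k + (e + 1) / m] ([ae_upper_local_dim_le]).

    As [m] is comparable with [- log (1 - 2 p)] when the porosity [p] is not
    small, this is the claim for [1 / 4 < p]. For smaller [p] the right-hand side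
    exceeds a constant that bounds the dimension almost everywhere, by the same
    estimate with [k = 0], where there are no holes. Finally, a porosity of [-oo]
    would make the right-hand side [-oo]; it does not occur, because singletons
    that carry a given proportion of the measure of a ball cannot be numerous in
    this ball ([porosity_ge0]). *)

Set Implicit Arguments.
Unset Strict Implicit.
Unset Printing Implicit Defensive.

Local Open Scope classical_set_scope.
Local Open Scope ring_scope.

(** * Euclidean geometry of row vectors *)

Section Euclid.
Variables (R : realType) (d : nat).
Implicit Types u v w : 'rV[R]_d.

Lemma dotpC u v : dotp u v = dotp v u.
Proof. by apply: eq_bigr => i _; rewrite mulrC. Qed.

Lemma dotpDl u v w : dotp (u + v) w = dotp u w + dotp v w.
Proof. by rewrite -big_split; apply: eq_bigr => i _; rewrite mxE mulrDl. Qed.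

Lemma dotpZl a u v : dotp (a *: u) v = a * dotp u v.
Proof. by rewrite big_distrr; apply: eq_bigr => i _; rewrite mxE /= mulrA. Qed.

Lemma dotpZr a u v : dotp u (a *: v) = a * dotp u v.
Proof. by rewrite dotpC dotpZl dotpC. Qed.

Lemma dotpNl u v : dotp (- u) v = - dotp u v.
Proof. by rewrite -scaleN1r dotpZl mulN1r. Qed.

Lemma dotpBl u v w : dotp (u - v) w = dotp u w - dotp v w.
Proof. by rewrite dotpDl dotpNl. Qed.

Lemma dotpBr u v w : dotp u (v - w) = dotp u v - dotp u w.
Proof. by rewrite dotpC dotpBl !(dotpC u). Qed.

Lemma dotp_ge0 u : 0 <= dotp u u.
Proof. by apply: sumr_ge0 => i _; rewrite -expr2 sqr_ge0. Qed.

Lemma enorm_ge0 u : 0 <= enorm u. Proof. exact: sqrtr_ge0. Qed.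

Lemma enorm_sqr u : enorm u ^+ 2 = dotp u u.
Proof. by rewrite sqr_sqrtr // dotp_ge0. Qed.

Lemma enorm0 : enorm (0 : 'rV[R]_d) = 0.
Proof. by rewrite /enorm -(scale0r 0) dotpZl mul0r sqrtr0. Qed.

Lemma enormN u : enorm (- u) = enorm u.
Proof. by rewrite /enorm dotpNl dotpC dotpNl opprK. Qed.

Lemma enorm_distC u v : enorm (u - v) = enorm (v - u).
Proof. by rewrite -enormN opprB. Qed.

Lemma enormZ a u : enorm (a *: u) = `|a| * enorm u.
Proof.
by rewrite /enorm dotpZl dotpZr mulrA -expr2 sqrtrM ?sqr_ge0 // sqrtr_sqr.
Qed.

Lemma coord_le_enorm u i : `|u 0 i| <= enorm u.
Proof.
rewrite -sqrtr_sqr ler_sqrt ?dotp_ge0 // /dotp (bigD1 i) //= -expr2 lerDl.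
by apply: sumr_ge0 => j _; rewrite -expr2 sqr_ge0.
Qed.

Lemma enorm_le_sum u : enorm u <= \sum_(i < d) `|u 0 i|.
Proof.
have s0 (P : pred 'I_d) : 0 <= \sum_(i | P i) `|u 0 i| by apply: sumr_ge0.
rewrite -(@ger0_norm _ (\sum_i _)) ?s0 // -sqrtr_sqr ler_sqrt ?sqr_ge0 //.
rewrite expr2 mulr_suml; apply: ler_sum => i _.
rewrite -expr2 -real_normK ?num_real // expr2 ler_wpM2l //.
by rewrite (bigD1 i) //= lerDl.
Qed.

Lemma enorm_eq0 u : enorm u = 0 -> u = 0.
Proof.
move=> u0; apply/rowP => i; rewrite mxE; apply/eqP; rewrite -normr_le0 -u0.
exact: coord_le_enorm.
Qed.

Lemma cauchy_schwarz u v : dotp u v <= enorm u * enorm v.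
Proof.
have [/enorm_eq0 ->|v0] := eqVneq (enorm v) 0.
  by rewrite enorm0 mulr0 -(scale0r 0) dotpZr mul0r.
have vgt0 : 0 < enorm v by rewrite lt_neqAle eq_sym v0 enorm_ge0.
have := dotp_ge0 (enorm v ^+ 2 *: u - dotp u v *: v).
rewrite dotpBl !dotpBr !dotpZl !dotpZr -!enorm_sqr (dotpC v u).
set a := enorm u; set b := enorm v; set t := dotp u v => h.
have {}h : 0 <= b ^+ 2 * ((a * b) ^+ 2 - t ^+ 2).
  by apply: le_trans h _; rewrite le_eqVlt; apply/orP; left; apply/eqP; ring.
rewrite pmulr_rge0 ?exprn_gt0 // subr_ge0 in h.
have ab0 : 0 <= a * b by rewrite mulr_ge0 ?enorm_ge0.
rewrite (le_trans (ler_norm t)) // -(ger0_norm ab0) -(@ler_pXn2r _ 2) ?nnegrE //.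
by rewrite !real_normK ?num_real.
Qed.

Lemma enormD u v : enorm (u + v) <= enorm u + enorm v.
Proof.
have h0 : 0 <= enorm u + enorm v by rewrite addr_ge0 ?enorm_ge0.
rewrite -(ler_pXn2r (ltn0Sn 1)) ?nnegrE ?enorm_ge0 //.
rewrite sqrrD !enorm_sqr dotpDl (dotpC u) (dotpC v) !dotpDl.
have := cauchy_schwarz u v; rewrite (dotpC v u); lra.
Qed.

Lemma enorm_tri u v w : enorm (u - w) <= enorm (u - v) + enorm (v - w).
Proof. by rewrite (le_trans _ (enormD _ _)) // addrA subrK. Qed.

(** Families are indexed by [nat] so that extending one does not change its type. *)
Definition orthonormal_upto (k : nat) (e : nat -> 'rV[R]_d) :=
  forall i j, (i < k)%N -> (j < k)%N -> dotp (e i) (e j) = (i == j)%:R.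

Lemma dotp_mx u v : dotp u v = (u *m v^T) 0 0.
Proof. by rewrite mxE; apply: eq_bigr => i _; rewrite mxE. Qed.

Lemma orthonormal_extend1 k e : (k < d)%N -> orthonormal_upto k e ->
  exists2 e', orthonormal_upto k.+1 e' & forall i, (i < k)%N -> e' i = e i.
Proof.
move=> kd oe.
pose E := \matrix_(i < k) e i.
have /rowV0Pn [v /sub_kermxP vE v0] : kermx E^T != 0.
  rewrite -mxrank_eq0 mxrank_ker subn_eq0 -ltnNge mxrank_tr.
  exact: leq_ltn_trans (rank_leq_row _) kd.
have ve i : (i < k)%N -> dotp v (e i) = 0.
  move=> ik; have /rowP /(_ (Ordinal ik)) := vE; rewrite !mxE => <-.
  by apply: eq_bigr => j _; rewrite !mxE.
have n0 : enorm v != 0 by apply: contra v0 => /eqP /enorm_eq0 ->.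
exists (fun i => if i == k then (enorm v)^-1 *: v else e i); last first.
  by move=> i ik; rewrite ltn_eqF.
move=> i j ik1 jk1.
have [eik|ik] := eqVneq i k; have [ejk|jk] := eqVneq j k.
- by rewrite eik ejk eqxx dotpZl dotpZr -enorm_sqr mulr1n; field.
- by rewrite eik (eq_sym k) (negPf jk) dotpZl ve ?mulr0 //; lia.
- by rewrite ejk (negPf ik) dotpZr dotpC ve ?mulr0 //; lia.
- by apply: oe; lia.
Qed.

Lemma orthonormal_complete k e : (k <= d)%N -> orthonormal_upto k e ->
  exists2 e', orthonormal_upto d e' & forall i, (i < k)%N -> e' i = e i.
Proof.
move=> kd; have [n] := ubnP (d - k); elim: n k kd e => // n IH k kd e dkn oe.
have [dk|kd'] := leqP d k.
  have dk2 : d = k by lia.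
  by exists e; rewrite ?dk2 //; subst k.
have [e1 o1 e1e] := orthonormal_extend1 kd' oe.
have [|e2 o2 e2e] := IH k.+1 kd' e1 _ o1; first lia.
by exists e2 => // i ik; rewrite e2e ?e1e // ltnW.
Qed.

Lemma enorm_le_frame e w : orthonormal_upto d e ->
  enorm w <= \sum_(i < d) `|dotp w (e i)|.
Proof.
move=> oe; pose O := \matrix_(i < d) e i.
have O1 : O *m O^T = 1%:M.
  apply/matrixP => i j; rewrite !mxE -val_eqE /= -(oe i j) // /dotp.
  by apply: eq_bigr => l _; rewrite !mxE.
have wE : w *m O^T = \row_i dotp w (e i).
  apply/rowP => i; rewrite !mxE /dotp; apply: eq_bigr => l _.
  by rewrite !mxE.
have -> : enorm w = enorm (\row_(i < d) dotp w (e i)).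
  rewrite -wE /enorm !dotp_mx trmx_mul trmxK mulmxA -(mulmxA w).
  by rewrite (mulmx1C O1) mulmx1.
by rewrite (le_trans (enorm_le_sum _)) //; apply: ler_sum => i _; rewrite mxE.
Qed.

End Euclid.

(** * Points lying outside each other's holes *)

Section Holes.
Variables (R : realType) (d : nat).
Implicit Types u v w : 'rV[R]_d.

(** Replacing [u] by a nearby [v] costs only a small multiple of [enorm w]:
    this is what allows nearly equal frames to be exchanged. *)
Lemma dotp_perturb w u v (h : R) :
  0 <= h -> (forall j, `|u 0 j - v 0 j| <= h) ->
  `|dotp w u - dotp w v| <= h * (d%:R * enorm w).
Proof.
move=> h0 uv; rewrite -dotpBr (le_trans (ler_norm_sum _ _ _)) //.
apply: (@le_trans _ _ (\sum_(j < d) h * `|w 0 j|)).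
  apply: ler_sum => j _; rewrite normrM mulrC ler_wpM2r // !mxE; exact: uv.
rewrite -mulr_sumr ler_wpM2l //.
apply: (@le_trans _ _ (\sum_(j < d) enorm w)).
  by apply: ler_sum => j _; exact: coord_le_enorm.
by rewrite sumr_const card_ord -[leLHS]mulr_natl.
Qed.

(** A ball of radius almost 1/2 whose center is at distance almost 1/2 from the
    origin looks like a half-space near the origin, up to a quadratic term for
    the curvature of the sphere and a term for the defect [h]. *)
Lemma hole_halfspace (h : R) w v : 0 <= h <= 4^-1 ->
  enorm v <= 2^-1 + h -> 2^-1 - h < enorm (w - v) ->
  4^-1 <= enorm v ->
  dotp w ((enorm v)^-1 *: v) <= 2 * enorm w ^+ 2 + 4 * h.
Proof.
move=> /andP[h0 h4] vh wvh v4; have v0 : 0 < enorm v by lra.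
rewrite dotpZr ler_pdivrMl //.
have : (2^-1 - h) ^+ 2 <= enorm (w - v) ^+ 2.
  by rewrite ler_pXn2r ?nnegrE ?enorm_ge0 //; lra.
have : enorm v ^+ 2 <= (2^-1 + h) ^+ 2.
  by rewrite ler_pXn2r ?nnegrE ?enorm_ge0 //; lra.
rewrite !enorm_sqr dotpBl !dotpBr (dotpC v w) => h1 h2.
have h5 : dotp w v <= 4^-1 * (2 * enorm w ^+ 2 + 4 * h).
  by rewrite enorm_sqr; lra.
apply: le_trans h5 _; rewrite -enorm_sqr; apply: ler_wpM2r => //.
by have := sqr_ge0 (enorm w); have := enorm_ge0 v; lra.
Qed.

(** The geometric heart of the proof. Let [w] be the difference of two nearby
    points, each outside the [k] holes attached to the other one, and suppose
    that both systems of hole directions are close to the same [e0]. By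
    [hole_halfspace], used from both points, [w] is almost orthogonal to the
    hole directions: such points lie on an approximate Lipschitz graph over the
    remaining [d - k] directions. So if [w] is also small in those directions,
    then it is small. *)
Lemma outside_holes_close k (h : R) w (v v' : 'I_k -> 'rV[R]_d)
    (e e' e0 : nat -> 'rV[R]_d) : (0 < d)%N -> 0 <= h <= 4^-1 ->
  orthonormal_upto d e ->
  (forall i : 'I_k, e i = (enorm (v i))^-1 *: v i) ->
  (forall i : 'I_k, e' i = (enorm (v' i))^-1 *: v' i) ->
  (forall i j, (i < d)%N -> `|e i 0 j - e0 i 0 j| <= (8 * d%:R ^+ 2)^-1) ->
  (forall i j, (i < d)%N -> `|e' i 0 j - e0 i 0 j| <= (8 * d%:R ^+ 2)^-1) ->
  (forall i, 4^-1 <= enorm (v i) <= 2^-1 + h) ->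
  (forall i, 4^-1 <= enorm (v' i) <= 2^-1 + h) ->
  (forall i, 2^-1 - h < enorm (w - v i)) ->
  (forall i, 2^-1 - h < enorm (- w - v' i)) ->
  enorm w <= (8 * d%:R)^-1 ->
  (forall i, (k <= i < d)%N -> `|dotp w (e0 i)| <= 2 * h) ->
  enorm w <= 8 * d%:R * h.
Proof.
move=> d0 h4 oe eE eE' ee0 ee0' vn vn' vh vh' w8 wk.
have dr : (0 : R) < d%:R by rewrite ltr0n.
have w0 := enorm_ge0 w.
(* All error terms proportional to [enorm w] are multiples of [z], and they add
   up to at most [4 * z] in each of the [d] directions. *)
set z := (8 * d%:R)^-1 * enorm w.
have z0 : 0 <= z by rewrite /z mulr_ge0 // invr_ge0 mulr_ge0.
have w2 : 2 * enorm w ^+ 2 <= 2 * z.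
  by rewrite ler_pM2l // expr2 ler_wpM2r.
have dz : (8 * d%:R ^+ 2)^-1 * (d%:R * enorm w) = z.
  by rewrite /z; field; rewrite gt_eqF.
have V0 : 0 <= (8 * d%:R ^+ 2)^-1 :> R.
  by rewrite invr_ge0 mulr_ge0 // exprn_ge0.
have wf (i : 'I_d) : `|dotp w (e i)| <= 4 * z + 4 * h.
  have := dotp_perturb w V0 (fun j => ee0 i j (ltn_ord i)).
  have := dotp_perturb w V0 (fun j => ee0' i j (ltn_ord i)).
  rewrite dz; have [ik|ki] := ltnP i k.
    pose i' := Ordinal ik.
    have /andP[vi1 vi2] := vn i'; have /andP[vi1' vi2'] := vn' i'.
    have := hole_halfspace h4 vi2 (vh i') vi1.
    have := hole_halfspace h4 vi2' (vh' i') vi1'.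
    rewrite enormN dotpNl -eE -eE' /= => p1 p2.
    by rewrite !ler_norml => /andP[? ?] /andP[? ?]; apply/andP; split; lra.
  have := wk i; rewrite ki ltn_ord !ler_norml => /(_ isT) /andP[? ?].
  by move=> /andP[? ?] /andP[? ?]; apply/andP; split; lra.
have := enorm_le_frame w oe => /le_trans /(_ (ler_sum _ (fun i _ => wf i))).
rewrite sumr_const card_ord -[leRHS]mulr_natl.
have -> : d%:R * (4 * z + 4 * h) = 2^-1 * enorm w + 4 * d%:R * h.
  by rewrite /z; field; rewrite gt_eqF.
lra.
Qed.

Lemma complete_frame k (v : 'I_k -> 'rV[R]_d) : (k <= d)%N ->
  (forall i, 0 < enorm (v i)) ->
  (forall i j, j != i -> dotp (v i) (v j) = 0) ->
  exists2 e, orthonormal_upto d e &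
    forall i : 'I_k, e i = (enorm (v i))^-1 *: v i.
Proof.
move=> kd v0 vo.
have [||e oe eE] := @orthonormal_complete R d k (fun n =>
    if insub n is Some i then (enorm (v i))^-1 *: v i else 0) => //.
  move=> i j ik jk; rewrite (insubT (fun n => n < k)%N ik).
  rewrite (insubT (fun n => n < k)%N jk) dotpZl dotpZr.
  set i' := Sub _ _; set j' := Sub _ _.
  have [ij|ij] := eqVneq i j; last by rewrite vo ?mulr0 // -val_eqE /= eq_sym.
  have -> : j' = i' by apply: val_inj; rewrite /= ij.
  by rewrite -enorm_sqr mulr1n; field; rewrite gt_eqF.
by exists e => // i; rewrite eE // valK.
Qed.

Lemma orthonormal_coord_le1 (e : nat -> 'rV[R]_d) i j :
  orthonormal_upto d e -> (i < d)%N -> `|e i 0 j| <= 1.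
Proof.
move=> oe id; apply: le_trans (coord_le_enorm _ _) _.
by rewrite -(@ler_pXn2r _ 2) ?nnegrE ?enorm_ge0 // enorm_sqr oe // eqxx expr1n.
Qed.

End Holes.

(** * Counting the cells that are not mutually in holes *)

Section Bucket.
Variable R : realType.

Definition bucket (n : nat) (t : R) : 'I_n.+1 := inord (Num.truncn t).

Lemma bucket_itv n (t : R) : 0 <= t <= n%:R ->
  (bucket n t)%:R <= t < (bucket n t)%:R + 1.
Proof.
move=> /andP[t0 tn]; rewrite /bucket inordK.
  by have := truncn_itv t0; rewrite -natr1.
by rewrite ltnS truncn_le_nat (le_lt_trans tn) // ltr_nat.
Qed.

Lemma bucket_eq n (s t : R) : 0 <= s <= n%:R -> 0 <= t <= n%:R ->
  bucket n s = bucket n t -> `|s - t| < 1.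
Proof.
move=> /bucket_itv /andP[s1 s2] /bucket_itv /andP[t1 t2] e.
rewrite ltr_norml; rewrite e in s1 s2; apply/andP; split; lra.
Qed.

(** The value that the bucket of a number of [`[-1, 1]] stands for. *)
Lemma bucket_decode n (x : R) : (0 < n)%N -> `|x| <= 1 ->
  let y := (bucket (2 * n) ((x + 1) * n%:R))%:R / n%:R - 1 in
  `|x - y| <= n%:R^-1 /\ `|y| <= 1.
Proof.
move=> n0; have n0r : (0 : R) < n%:R by rewrite ltr0n.
rewrite ler_norml => /andP[x1 x2] y.
have xI : 0 <= (x + 1) * n%:R <= (2 * n)%:R.
  rewrite natrM ler_pM2r // mulr_ge0 ?(ltW n0r) //=; lra.
have t2n : (bucket (2 * n) ((x + 1) * n%:R))%:R <= (2 * n)%:R :> R.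
  by rewrite ler_nat -ltnS ltn_ord.
have := bucket_itv xI; rewrite /y.
set t := (bucket _ _)%:R in t2n * => /andP[t1 t2].
have t0 : 0 <= t by rewrite /t.
split; last first.
  have tn0 : 0 <= t / n%:R by rewrite divr_ge0.
  have tn2 : t / n%:R <= 2 by rewrite ler_pdivrMr // -natrM.
  by rewrite ler_norml; apply/andP; split; lra.
have -> : x - (t / n%:R - 1) = ((x + 1) * n%:R - t) / n%:R.
  by field; rewrite gt_eqF.
rewrite normrM (@ger0_norm _ n%:R^-1) ?invr_ge0 ?(ltW n0r) //.
rewrite -[leRHS]mul1r ler_pM2r ?invr_gt0 //.
by rewrite ler_norml; apply/andP; split; lra.
Qed.

End Bucket.

Lemma modn_close_inj (R : realType) (l x y : nat) :
  `|y%:R - x%:R| < l%:R :> R -> (x %% l = y %% l)%N -> x = y.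
Proof.
rewrite ltr_norml => /andP[p1 p2].
have : (x < y + l)%N by rewrite -(ltr_nat R) natrD; lra.
have : (y < x + l)%N by rewrite -(ltr_nat R) natrD; lra.
clear p1 p2; wlog le : x y / (x <= y)%N => [IH yx xy e|yx xy e].
  by case: (leqP x y) => [/IH|/ltnW/IH]; [apply|move=> /(_ xy yx (esym e))].
have : (l %| y - x)%N by rewrite -eqn_mod_dvd //; apply/eqP.
by move=> /dvdnP [[|q]]; nia.
Qed.

Lemma box_count_le (d k N : nat) : (0 < d)%N -> (0 < N)%N ->
  ((2 * d * N).+1 ^ (d - k) <= (3 * d) ^ d * N ^ (d - k))%N.
Proof.
move=> d0 N0; apply: (@leq_trans ((3 * d * N) ^ (d - k))).
  have [->|dk] := posnP (d - k); first by rewrite !expn0.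
  rewrite leq_exp2r //; nia.
by rewrite expnMn leq_mul // leq_pexp2l ?leq_subr // muln_gt0.
Qed.

(** The cube with corner [a] and side 1 is cut into [N ^ d] subcubes [b], some
    of which contain a point [u b] at which [k] holes [v b] are attached. If the
    holes, once shrunk by [C1 / N], contain none of these points, then only
    [O(N ^ (d - k))] subcubes are involved. Each of them is encoded by its frame
    of hole directions and its position, both up to a constant precision, by its
    index modulo a constant [L], and by the coordinates of [u b] in the [d - k]
    last directions of the frame up to precision [1 / N]. As
    [outside_holes_close] bounds the distance of two points that agree on all but
    the third item, that item then determines the subcube. *)
Lemma holes_card_le (R : realType) (d C1 k N : nat) (a : 'I_d -> R)
    (H : {set {ffun 'I_d -> 'I_N}}) (u : {ffun 'I_d -> 'I_N} -> 'rV[R]_d)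
    (v : {ffun 'I_d -> 'I_N} -> 'I_k -> 'rV[R]_d) :
  (0 < d)%N -> (k <= d)%N -> (4 * C1 + 2 <= N)%N ->
  (forall b i, b \in H ->
     (b i)%:R <= N%:R * (u b 0 i - a i) <= (b i)%:R + 1) ->
  (forall b i, b \in H -> enorm (v b i) <= (1 + N%:R^-1) / 2) ->
  (forall b i j, b \in H -> j != i -> dotp (v b i) (v b j) = 0) ->
  (forall b b' i, b \in H -> b' \in H ->
     (1 - N%:R^-1) / 2 - C1%:R / N%:R < enorm (u b' - u b - v b i)) ->
  (#|H| <= ((2 * (8 * d ^ 2)).+1 ^ (d * d) * (8 * d ^ 2).+1 ^ d *
            (4 * d + 8 * d * C1).+2 ^ d * (3 * d) ^ d) * N ^ (d - k))%N.
Proof.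
move=> d0 kd NC ub vn vo vh.
have N_gt0 : (0 < N)%N by apply: leq_trans NC; rewrite addn2.
have N0 : (0 : R) < N%:R by rewrite ltr0n.
have dr : (0 : R) < d%:R by rewrite ltr0n.
have C0 : (0 : R) <= C1%:R by [].
(* [h] bounds both errors: that of the center and that of the shrunk radius. *)
pose h : R := (2^-1 + C1%:R) / N%:R.
have h4 : 0 <= h <= 4^-1.
  have : (4 * C1 + 2)%:R <= N%:R :> R by rewrite ler_nat.
  rewrite natrD natrM => NC'.
  by rewrite /h divr_ge0 ?ler_pdivrMr //; lra.
have hN : N%:R^-1 <= 2 * h.
  rewrite /h mulrA -[leLHS]mul1r ler_wpM2r ?invr_ge0 ?(ltW N0) //; lra.
have hE : (1 - N%:R^-1) / 2 - C1%:R / N%:R = 2^-1 - h.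
  by rewrite /h; field; rewrite gt_eqF.
have vN b i : b \in H -> 4^-1 <= enorm (v b i) <= 2^-1 + h.
  move=> bH; have := vh b b i bH bH; rewrite subrr sub0r enormN hE => h1.
  by have h2 := vn b i bH; apply/andP; split; lra.
have fr b : exists e : nat -> 'rV[R]_d, b \in H -> orthonormal_upto d e /\
    forall i : 'I_k, e i = (enorm (v b i))^-1 *: v b i.
  have [bH|bH] := boolP (b \in H); last by exists (fun=> 0).
  have v0 i : 0 < enorm (v b i) by have /andP[? _] := vN b i bH; lra.
  have [e oe eE] := complete_frame kd v0 (fun i j => vo b i j bH).
  by exists e.
have [e eP] := fin_all_exists fr.
pose n := (8 * d ^ 2)%N.
have n0 : (0 < n)%N by rewrite muln_gt0 expn_gt0 d0.
have n0r : (0 : R) < n%:R by rewrite ltr0n.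
have nE : n%:R = 8 * d%:R ^+ 2 :> R by rewrite /n natrM natrX.
(* [f1] is the code of the frame, and [e0] decodes it: the reference directions
   depend only on the code. *)
pose f1 b : {ffun 'I_d * 'I_d -> 'I_(2 * n).+1} := [ffun ij : 'I_d * 'I_d =>
  bucket (2 * n) ((e b ij.1 0 ij.2 + 1) * n%:R)].
pose e0 (t : {ffun 'I_d * 'I_d -> 'I_(2 * n).+1}) i : 'rV[R]_d :=
  \row_j ((if insub i is Some i' then (t (i', j))%:R else 0) / n%:R - 1).
pose f2 b : {ffun 'I_d -> 'I_n.+1} :=
  [ffun i => bucket n ((u b 0 i - a i) * n%:R)].
pose L := (4 * d + 8 * d * C1).+2.
pose f3 (b : {ffun 'I_d -> 'I_N}) : {ffun 'I_d -> 'I_L} :=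
  [ffun i => inord (b i %% L)].
pose ar : 'rV[R]_d := \row_i a i.
pose f4 b : {ffun 'I_(d - k) -> 'I_(2 * d * N).+1} := [ffun i : 'I_(d - k) =>
  bucket (2 * d * N)
    (N%:R * (dotp (u b - ar) (e0 (f1 b) (k + i)%N) + d%:R))].
have e0P b i j : b \in H -> (i < d)%N ->
    `|e b i 0 j - e0 (f1 b) i 0 j| <= n%:R^-1 /\ `|e0 (f1 b) i 0 j| <= 1.
  move=> bH id; rewrite !mxE (insubT (fun m => m < d)%N id) ffunE /=.
  exact: bucket_decode n0 (orthonormal_coord_le1 j (eP b bH).1 id).
have u01 b j : b \in H -> 0 <= u b 0 j - a j <= 1.
  move=> bH; have /andP[h1 h2] := ub b j bH.
  have : (b j).+1%:R <= N%:R :> R by rewrite ler_nat.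
  have b0 : (0 : R) <= (b j)%:R by [].
  rewrite -natr1 => bN.
  rewrite -(pmulr_rge0 _ N0) -[_ <= 1](ler_pM2l N0) mulr1.
  by apply/andP; split; lra.
have finj : {in H &, injective (fun b => (f1 b, f2 b, f3 b, f4 b))}.
  move=> b b' bH b'H [E1 E2 E3 E4].
  pose w := u b' - u b.
  have wj j : `|w 0 j| <= n%:R^-1.
    have hb b1 : b1 \in H -> 0 <= (u b1 0 j - a j) * n%:R <= n%:R.
      move=> /(u01 b1 j)/andP[? ?].
      by apply/andP; split; [rewrite mulr_ge0|rewrite ler_piMl].
    have /ffunP /(_ j) := E2; rewrite !ffunE => /(bucket_eq (hb b bH) (hb b' b'H)).
    rewrite -mulrBl normrM (ger0_norm (ltW n0r)) => /ltW.
    by rewrite -ler_pdivlMr // div1r !mxE distrC opprB addrA subrK.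
  have w8 : enorm w <= (8 * d%:R)^-1.
    apply: le_trans (enorm_le_sum _) _.
    apply: (@le_trans _ _ (\sum_(j < d) n%:R^-1)); first exact: ler_sum.
    rewrite sumr_const card_ord -[leLHS]mulr_natl nE.
    suff -> : d%:R / (8 * d%:R ^+ 2) = (8 * d%:R)^-1 :> R by [].
    by field; rewrite gt_eqF.
  have wk i : (k <= i < d)%N -> `|dotp w (e0 (f1 b) i)| <= 2 * h.
    move=> /andP[ki id].
    have ikd : (i - k < d - k)%N by rewrite ltn_sub2r // (leq_ltn_trans ki).
    have hb b1 : b1 \in H -> f1 b1 = f1 b ->
        0 <= N%:R * (dotp (u b1 - ar) (e0 (f1 b) i) + d%:R) <= (2 * d * N)%:R.
      move=> b1H f1E.
      have : `|dotp (u b1 - ar) (e0 (f1 b) i)| <= d%:R.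
        apply: le_trans (ler_norm_sum _ _ _) _.
        apply: (@le_trans _ _ (\sum_(j < d) 1)); last by rewrite sumr_const card_ord.
        apply: ler_sum => j _; rewrite normrM mulr_ile1 ?(e0P b i j bH id).2 //.
        by have /andP[? ?] := u01 b1 j b1H; rewrite !mxE ger0_norm.
      rewrite ler_norml => /andP[h1 h2]; apply/andP; split.
        by rewrite mulr_ge0 ?(ltW N0) // -(lerBlDr _ _) sub0r.
      rewrite !natrM mulrC ler_wpM2r ?(ltW N0) //.
      by rewrite mulr_natl mulr2n lerD2r.
    have /ffunP /(_ (Ordinal ikd)) := E4; rewrite !ffunE /= subnKC // -E1.
    move=> /(bucket_eq (hb b bH erefl) (hb b' b'H (esym E1))).
    rewrite -mulrBr normrM (ger0_norm (ltW N0)) opprD addrACA subrr addr0 -dotpBl.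
    have -> : u b - ar - (u b' - ar) = - w by rewrite /w opprB opprB addrA subrK.
    rewrite dotpNl normrN => wN; apply: le_trans hN.
    by rewrite -div1r ler_pdivlMr // mulrC ltW.
  have w8h : enorm w <= 8 * d%:R * h.
    apply: (@outside_holes_close R d k h w (v b) (v b') (e b) (e b') (e0 (f1 b))) => //.
    - exact: (eP b bH).1.
    - exact: (eP b bH).2.
    - exact: (eP b' b'H).2.
    - by move=> i j id; rewrite -nE; exact: (e0P b i j bH id).1.
    - by move=> i j id; rewrite -nE E1; exact: (e0P b' i j b'H id).1.
    - by move=> i; exact: vN.
    - by move=> i; exact: vN.
    - by move=> i; rewrite -hE; exact: vh.
    - by move=> i; rewrite -hE /w opprB; exact: vh.
  apply/ffunP => i; apply: val_inj => /=.
  have /(congr1 val) : f3 b i = f3 b' i by rewrite E3.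
  rewrite !ffunE /= !inordK ?ltn_pmod //.
  have : `|(b' i)%:R - (b i)%:R| < L%:R :> R.
    have := ub b i bH; have := ub b' i b'H.
    have : `|w 0 i| <= 8 * d%:R * h by apply: le_trans (coord_le_enorm _ _) w8h.
    rewrite !mxE -(ler_pM2l N0) -[X in X * `|_|](ger0_norm (ltW N0)) -normrM.
    have -> : N%:R * (8 * d%:R * h) = 4 * d%:R + 8 * d%:R * C1%:R.
      by rewrite /h; field; rewrite gt_eqF.
    have -> : L%:R = 4 * d%:R + 8 * d%:R * C1%:R + 2 :> R.
      by rewrite /L -addn2 !natrD !natrM; ring.
    clear -N0.
    rewrite mulrBr !ltr_norml !ler_norml mulrBr.
    by move=> /andP[? ?] /andP[? ?] /andP[? ?]; apply/andP; split; lra.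
  exact: modn_close_inj.
rewrite (leq_trans (leq_card_in _ _ finj)) //.
rewrite !card_prod !card_ffun !card_ord card_prod !card_ord.
by rewrite -[leqRHS]mulnA leq_mul // box_count_le.
Qed.

(** * Cells and their neighborhoods *)

Lemma outer_measure_big_le (T : Type) (R : realType) (I : finType)
    (mu : {outer_measure set T -> \bar R}) (F : I -> set T) :
  (mu (\big[setU/set0]_i F i) <= \sum_i mu (F i))%E.
Proof.
elim/big_rec2: _ => [|i x y _ IH]; first by rewrite outer_measure0.
by rewrite (le_trans (outer_measureU2 _ _ _)) // leeD2l.
Qed.

Section Balls.
Variables (R : realType) (d : nat).
Implicit Types (x y z c : 'rV[R]_d).

Lemma eball_subset c c' (r r' : R) : enorm (c - c') + r <= r' ->
  eball c r `<=` eball c' r'.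
Proof.
move=> h y; rewrite /eball /= => yc.
by apply: le_trans (enorm_tri y c c') _; lra.
Qed.

Lemma bounded_eball c (r : R) : bounded_set (eball c r).
Proof.
exists (enorm c + r); split; first exact: num_real.
move=> M hM y; rewrite /eball /= => yc.
have yM : enorm y <= M.
  have := enorm_tri y c 0; rewrite !subr0; lra.
rewrite /Num.norm /= mx_normrE; apply: bigmax_le => [|[i j] _ /=].
  exact: le_trans (enorm_ge0 y) yM.
by rewrite ord1; apply: le_trans (coord_le_enorm y j) yM.
Qed.

Variable mu : {outer_measure set 'rV[R]_d -> \bar R}.
Hypothesis mu_meas : is_measure mu.

Lemma eball_fin_num c r : mu (eball c r) \is a fin_num.
Proof.
by rewrite ge0_fin_numE ?outer_measure_ge0 //; apply: (bounded_finite mu_meas);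
  exact: bounded_eball.
Qed.

Variable N : nat.
Hypothesis N_gt1 : (1 < N)%N.

Let N0 : (0 : R) < N%:R. Proof. by rewrite ltr0n; lia. Qed.
Let NX0 j : (0 : R) < N%:R ^+ j. Proof. exact: exprn_gt0. Qed.

Definition cell j z : {ffun 'I_d -> int} :=
  [ffun i => Num.floor (N%:R ^+ j * z 0 i)].

Definition corner j (a : {ffun 'I_d -> int}) : 'rV[R]_d :=
  \row_i ((a i)%:~R / N%:R ^+ j).

Definition child (a : {ffun 'I_d -> int}) (b : {ffun 'I_d -> 'I_N}) :
    {ffun 'I_d -> int} :=
  [ffun i => N%:Z * a i + (b i : nat)%:Z].

(** The ball is centered at the corner of the cell [a] of level [j] and has
    [2 * d + 2] times its side as radius: this is large enough to contain the
    balls of the children, and the balls of radius one side around the points of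
    the cell. *)
Definition mass j a : R :=
  fine (mu (eball (corner j a) ((2 * d + 2)%:R / N%:R ^+ j))).

Lemma mass_ge0 j a : 0 <= mass j a.
Proof. by rewrite fine_ge0 // outer_measure_ge0. Qed.

Lemma massE j a :
  (mass j a)%:E = mu (eball (corner j a) ((2 * d + 2)%:R / N%:R ^+ j)).
Proof. by rewrite fineK // eball_fin_num. Qed.

Lemma cell_itv j z i : 0 <= N%:R ^+ j * z 0 i - (cell j z i)%:~R < 1.
Proof.
rewrite ffunE; have := floor_itv (N%:R ^+ j * z 0 i).
by rewrite intrD => /andP[? ?]; apply/andP; split; lra.
Qed.

Lemma enorm_coord_le (w : 'rV[R]_d) (h : R) :
  (forall i, `|w 0 i| <= h) -> enorm w <= d%:R * h.
Proof.
move=> wh; rewrite (le_trans (enorm_le_sum _)) //.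
rewrite (le_trans (ler_sum _ (fun i _ => wh i))) //.
by rewrite sumr_const card_ord -[leLHS]mulr_natl.
Qed.

Lemma corner_dist j z : enorm (z - corner j (cell j z)) <= d%:R / N%:R ^+ j.
Proof.
apply: enorm_coord_le => i; rewrite !mxE.
have -> : z 0 i - (cell j z i)%:~R / N%:R ^+ j =
    (N%:R ^+ j * z 0 i - (cell j z i)%:~R) / N%:R ^+ j.
  by field; rewrite gt_eqF.
have /andP[h1 h2] := cell_itv j z i.
by rewrite ger0_norm ?divr_ge0 ?(ltW (NX0 j)) // ler_pdivrMr // mulVf ?gt_eqF // ltW.
Qed.

Lemma cell_child j z : exists b, cell j.+1 z = child (cell j z) b.
Proof.
suff /fin_all_exists [b bP] : forall i, exists bi : 'I_N,
    cell j.+1 z i = N%:Z * cell j z i + (bi : nat)%:Z.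
  by exists [ffun i => b i]; apply/ffunP => i; rewrite bP !ffunE.
move=> i; have /andP[h1 h2] := cell_itv j z i.
have /andP[h3 h4] := cell_itv j.+1 z i.
pose t := cell j.+1 z i - N%:Z * cell j z i.
have tE : t%:~R = (cell j.+1 z i)%:~R - N%:R * (cell j z i)%:~R :> R.
  by rewrite /t rmorphB rmorphM.
move: h3 h4; rewrite exprS -mulrA => h3 h4.
have h1' := mulr_ge0 (ltW N0) h1.
have h2' : 0 < N%:R * (1 - (N%:R ^+ j * z 0 i - (cell j z i)%:~R)).
  by rewrite mulr_gt0 // subr_gt0.
have t0 : 0 <= t.
  by rewrite -ltzD1 -(ltr_int R) intrD tE; lra.
have tN : (`|t| < N)%N.
  by rewrite -(ltr_nat R) natr_absz ger0_norm // tE; lra.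
exists (Ordinal tN) => /=; rewrite gez0_abs // /t; lia.
Qed.

Lemma cell_parent j z a b : cell j.+1 z = child a b -> cell j z = a.
Proof.
move=> e; apply/ffunP => i; have /andP[h1 h2] := cell_itv j.+1 z i.
move: h1 h2; rewrite e ffunE intrD intrM exprS -mulrA => h1 h2.
have /andP[h3 h4] := cell_itv j z i.
have h1' := mulr_ge0 (ltW N0) h3.
have h2' : 0 < N%:R * (1 - (N%:R ^+ j * z 0 i - (cell j z i)%:~R)).
  by rewrite mulr_gt0 // subr_gt0.
have bN : (b i : nat)%:R + 1 <= N%:R :> R by rewrite natr1 ler_nat.
have b0 : (0 : R) <= (b i : nat)%:R by [].
have h5 : (a i)%:~R - (cell j z i)%:~R < 1 :> R.
  by rewrite -(ltr_pM2l N0) mulr1 mulrBr; lra.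
have h6 : (cell j z i)%:~R - (a i)%:~R < 1 :> R.
  by rewrite -(ltr_pM2l N0) mulr1 mulrBr; lra.
by apply/eqP; rewrite eq_le -!ltzD1 -!(ltr_int R) !intrD; apply/andP; split; lra.
Qed.

Lemma child_itv j z a b i : cell j.+1 z = child a b ->
  (b i)%:R <= N%:R * ((N%:R ^+ j *: z) 0 i - (a i)%:~R) <= (b i)%:R + 1.
Proof.
move=> e; have := cell_itv j.+1 z i; rewrite e ffunE intrD intrM !mxE exprS -mulrA.
by move=> /andP[? ?]; apply/andP; split; lra.
Qed.

Lemma child_ball_subset j a b :
  eball (corner j.+1 (child a b)) ((2 * d + 2)%:R / N%:R ^+ j.+1) `<=`
  eball (corner j a) ((2 * d + 2)%:R / N%:R ^+ j).
Proof.
apply: eball_subset.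
have cc : enorm (corner j.+1 (child a b) - corner j a) <= d%:R / N%:R ^+ j.
  apply: enorm_coord_le => i; rewrite !mxE ffunE intrD intrM exprS.
  have -> : (N%:R * (a i)%:~R + (b i : nat)%:R) / (N%:R * N%:R ^+ j) -
      (a i)%:~R / N%:R ^+ j =
    ((b i : nat)%:R / N%:R) / N%:R ^+ j :> R.
    by field; rewrite !gt_eqF.
  rewrite ger0_norm ?divr_ge0 ?(ltW (NX0 j)) // ler_pdivrMr // mulVf ?gt_eqF //.
  by rewrite ler_pdivrMr // mul1r ler_nat ltnW.
apply: le_trans (lerD cc (lexx _)) _.
rewrite exprS invfM mulrA -mulrDl ler_wpM2r ?invr_ge0 ?(ltW (NX0 j)) //.
have N2 : (2 : R) <= N%:R by rewrite ler_nat.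
have : (2 * d + 2)%:R / N%:R <= d%:R + 1 :> R.
  rewrite ler_pdivrMr // natrD natrM.
  have : (0 : R) <= d%:R by []. nra.
by rewrite natrD natrM; have : (0 : R) <= d%:R by []; lra.
Qed.

Lemma mass_child_le j a b : mass j.+1 (child a b) <= mass j a.
Proof.
rewrite -lee_fin !massE; apply: le_outer_measure; exact: child_ball_subset.
Qed.

End Balls.

(** * Decay of the measure of thin sets *)

(** The condition on [rho = q] in the definition of [por_scale]. *)
Definition holes (R : realType) (d k : nat)
    (mu : {outer_measure set 'rV[R]_d -> \bar R}) (q r eps : R) (x : 'rV[R]_d) : Prop :=
  exists y : 'I_k -> 'rV[R]_d,
    (forall i, (mu (eball (y i) (q * r)) <= eps%:E * mu (eball x r))%E /\
               q * r + enorm (x - y i) <= r) /\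
    (forall i j, j != i -> dotp (y i - x) (y j - x) = 0).

(** The first term comes from [holes_card_le], with [C1 = 3 * d + 2]; the second
    one bounds the number of all children when [N] is too small for that lemma. *)
Definition hole_bound (d : nat) : nat :=
  ((2 * (8 * d ^ 2)).+1 ^ (d * d) * (8 * d ^ 2).+1 ^ d *
    (4 * d + 8 * d * (3 * d + 2)).+2 ^ d * (3 * d) ^ d +
  (4 * (3 * d + 2) + 2) ^ d)%N.

Section Decay.
Variables (R : realType) (d k N j0 : nat).
Variable mu : {outer_measure set 'rV[R]_d -> \bar R}.
Hypothesis mu_meas : is_measure mu.
Hypotheses (d_gt0 : (0 < d)%N) (k_le : (k <= d)%N) (N_gt1 : (1 < N)%N).
Variables (A : set 'rV[R]_d) (eps : R).
Hypothesis eps_ge0 : 0 <= eps.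
Hypothesis A_holes : forall z j, A z -> (j0 <= j)%N ->
  holes k mu ((1 - N%:R^-1) / 2) (N%:R ^+ j)^-1 eps z.

Let N0 : (0 : R) < N%:R. Proof. by rewrite ltr0n; lia. Qed.
Let NX0 j : (0 : R) < N%:R ^+ j. Proof. exact: exprn_gt0. Qed.

Definition heavy j a : {set {ffun 'I_d -> 'I_N}} :=
  [set b | `[< exists2 z, A z & cell N j.+1 z = child a b >] &&
           (eps * mass mu N j a < mass mu N j.+1 (child a b))]%SET.

(** The ball of a child that has a point well inside a hole is contained in this
    hole, so that the child is not heavy: the points of [A] in heavy children are
    outside each other's holes. *)
Lemma heavy_card_le j a : (j0 <= j)%N ->
  (#|heavy j a| <= hole_bound d * N ^ (d - k))%N.
Proof.
move=> j0j; rewrite mulnDl.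
have [NC|NC] := leqP (4 * (3 * d + 2) + 2) N; last first.
  rewrite (leq_trans _ (leq_addl _ _)) // (leq_trans (max_card _)) //.
  rewrite card_ffun !card_ord -[leqLHS]muln1; apply: leq_mul.
    by rewrite leq_exp2r // ltnW.
  by rewrite expn_gt0 (ltnW N_gt1).
rewrite (leq_trans _ (leq_addr _ _)) //.
pose P b (zy : 'rV[R]_d * ('I_k -> 'rV[R]_d)) := b \in heavy j a ->
  [/\ A zy.1, cell N j.+1 zy.1 = child a b,
    (forall i, (mu (eball (zy.2 i) ((1 - N%:R^-1) / 2 * (N%:R ^+ j)^-1)) <=
                eps%:E * mu (eball zy.1 (N%:R ^+ j)^-1))%E /\
       (1 - N%:R^-1) / 2 * (N%:R ^+ j)^-1 + enorm (zy.1 - zy.2 i) <= (N%:R ^+ j)^-1) &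
    (forall i i', i' != i -> dotp (zy.2 i - zy.1) (zy.2 i' - zy.1) = 0)].
have /fin_all_exists [zy zyP] : forall b, exists zy, P b zy.
  move=> b; have [bH|bH] := boolP (b \in heavy j a); last first.
    by exists (0, fun=> 0) => bH'; rewrite bH' in bH.
  move: (bH); rewrite inE => /andP[/asboolP [z Az zb] _].
  have [y [y1 y2]] := A_holes Az j0j.
  by exists (z, y) => _.
apply: (@holes_card_le R d (3 * d + 2) k N (fun i => (a i)%:~R) (heavy j a)
  (fun b => N%:R ^+ j *: (zy b).1)
  (fun b i => N%:R ^+ j *: ((zy b).2 i - (zy b).1))) => //.
- by move=> b i bH; have [_ zb _ _] := zyP b bH; exact: child_itv.
- move=> b i bH; have [_ _ /(_ i)[_ h] _] := zyP b bH.
  rewrite enormZ enorm_distC ger0_norm ?(ltW (NX0 j)) //.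
  rewrite -lerBrDl in h; rewrite mulrC -ler_pdivlMr //.
  apply: le_trans h _; rewrite le_eqVlt; apply/orP; left; apply/eqP.
  by field; rewrite !gt_eqF.
- move=> b i i' bH ii'; have [_ _ _ h] := zyP b bH.
  by rewrite dotpZl dotpZr h // !mulr0.
move=> b b' i bH b'H; have [Az zb /(_ i)[hy _] _] := zyP b bH.
have [Az' zb' _ _] := zyP b' b'H.
have := b'H; rewrite inE => /andP[_]; rewrite !ltNge; apply: contra.
rewrite -!scalerBr enormZ ger0_norm ?(ltW (NX0 j)) // => h.
rewrite -lee_fin EFinM !massE //.
apply: (@le_trans _ _ (mu (eball ((zy b).2 i) ((1 - N%:R^-1) / 2 * (N%:R ^+ j)^-1)))).
  (* In units of [N ^- j.+1], the constant [3 * d + 2] is the distance [d] from the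
     point to the corner plus the radius [2 * d + 2] of the ball of the child. *)
  apply: le_outer_measure; apply: eball_subset.
  have e1 : (zy b').1 - (zy b).1 - ((zy b).2 i - (zy b).1) = (zy b').1 - (zy b).2 i.
    by rewrite opprB addrA subrK.
  rewrite e1 mulrC -ler_pdivlMr // in h.
  apply: le_trans (lerD (enorm_tri _ (zy b').1 _) (lexx _)) _.
  have := corner_dist N_gt1 j.+1 (zy b').1; rewrite zb' enorm_distC => h2.
  apply: le_trans (lerD (lerD h2 h) (lexx _)) _.
  rewrite exprS le_eqVlt; apply/orP; left; apply/eqP.
  by rewrite -?natrM ?natrD ?natrM; field; rewrite !gt_eqF.
apply: le_trans hy _; apply: lee_wpmul2l; first by rewrite lee_fin.
apply: le_outer_measure; apply: eball_subset.
have := corner_dist N_gt1 j (zy b).1; rewrite (cell_parent N_gt1 zb) => h2.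
apply: le_trans (lerD h2 (lexx _)) _.
rewrite -[X in _ + X]div1r -mulrDl ler_wpM2r ?invr_ge0 ?(ltW (NX0 j)) //.
by rewrite -[1 : R]/(1%:R) -natrD ler_nat; lia.
Qed.

Variables (M theta t : R).
Hypotheses (theta_gt0 : 0 < theta) (theta_lt1 : theta < 1) (t_gt0 : 0 < t).
Hypothesis M_ge : (hole_bound d * N ^ (d - k))%:R <= M.
Hypothesis eps_small : (N ^ d)%:R * eps `^ theta <= M.

Definition thin j n a : set 'rV[R]_d :=
  [set z | [/\ A z, cell N j z = a & mass mu N (j + n) (cell N (j + n) z) <= t]].

(** By induction on [n], covering a cell with its children: a heavy child
    contributes at most as much as the cell itself, and all the light children
    together contribute at most [N ^ d * eps ^ theta <= M] times as much. *)
Lemma thin_le j n a : (j0 <= j)%N ->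
  (mu (thin j n a) <= (t `^ (1 - theta) * (2 * M) ^+ n * mass mu N j a `^ theta)%:E)%E.
Proof.
have M0 : 0 <= M by apply: le_trans M_ge.
elim: n j a => [|n IH] j a j0j.
  rewrite expr0 mulr1.
  have [[z [Az za]]|nz] := pselect (exists z, thin j 0 a z); last first.
    have -> : thin j 0 a = set0.
      by apply/seteqP; split => // z hz; case: nz; exists z.
    by rewrite outer_measure0 lee_fin mulr_ge0 ?powR_ge0.
  rewrite addn0 za => mt.
  apply: (@le_trans _ _ (mass mu N j a)%:E).
    rewrite massE //; apply: le_outer_measure => x [_ <- _].
    have := corner_dist N_gt1 j x; rewrite /eball /= => h.
    by apply: le_trans h _; rewrite ler_wpM2r ?invr_ge0 ?(ltW (NX0 j)) // ler_nat; lia.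
  rewrite lee_fin; set m := mass _ _ _ _ in mt *.
  have m0 : 0 <= m := mass_ge0 _ _ _ _.
  have [->|mn0] := eqVneq m 0; first by rewrite mulr_ge0 ?powR_ge0.
  rewrite -[leLHS]powRr1 // -[X in m `^ X](subrK theta) powRD; last by rewrite mn0 implybT.
  by rewrite ler_wpM2r ?powR_ge0 // ge0_ler_powR ?nnegrE ?subr_ge0 ?(ltW theta_lt1) // ltW.
set F := t `^ (1 - theta) * (2 * M) ^+ n.
have F0 : 0 <= F by rewrite /F mulr_ge0 ?powR_ge0 ?exprn_ge0 ?mulr_ge0.
set m := mass mu N j a; have m0 : 0 <= m := mass_ge0 _ _ _ _.
have sub : thin j n.+1 a `<=`
    \big[setU/set0]_(b : {ffun 'I_d -> 'I_N}) thin j.+1 n (child a b).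
  move=> z [Az za mz]; have [b zb] := cell_child N_gt1 j z.
  rewrite (bigD1 b) //=; left; split => //; first by rewrite zb za.
  by rewrite addSnnS.
apply: le_trans (le_outer_measure mu _ _ sub) _.
apply: le_trans (outer_measure_big_le _ _) _.
have bnd b : (mu (thin j.+1 n (child a b)) <=
    (F * m `^ theta * ((b \in heavy j a)%:R + eps `^ theta))%:E)%E.
  have [[z [Az za _]]|nz] := pselect (exists z, thin j.+1 n (child a b) z); last first.
    have -> : thin j.+1 n (child a b) = set0.
      by apply/seteqP; split => // z hz; case: nz; exists z.
    rewrite outer_measure0 lee_fin; apply: mulr_ge0.
      by rewrite mulr_ge0 // powR_ge0.
    by rewrite addr_ge0 // powR_ge0.
  apply: le_trans (IH j.+1 (child a b) _) _; first exact: leqW.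
  rewrite -/F lee_fin -mulrA ler_wpM2l //.
  have c0 := mass_ge0 mu N j.+1 (child a b).
  have [bH|bH] := boolP (b \in heavy j a).
    apply: (@le_trans _ _ (m `^ theta)).
      by rewrite ge0_ler_powR ?nnegrE ?(ltW theta_gt0) // mass_child_le.
    by rewrite -[leLHS]mulr1 ler_wpM2l ?powR_ge0 // lerDl powR_ge0.
  rewrite add0r mulrC -powRM //.
  rewrite ge0_ler_powR ?nnegrE ?(ltW theta_gt0) ?mulr_ge0 //.
  move: bH; rewrite inE negb_and -leNgt => /orP[/asboolPn []|//].
  by exists z.
apply: le_trans (lee_sum _ (fun b _ => bnd b)) _.
rewrite sumEFin lee_fin -mulr_sumr big_split /= sumr_const card_ffun !card_ord.
have -> : \sum_(b : {ffun 'I_d -> 'I_N}) (b \in heavy j a)%:R = #|heavy j a|%:R :> R.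
  rewrite -sum1_card natr_sum [RHS]big_mkcond.
  by apply: eq_bigr => b _; case: ifP.
have -> : t `^ (1 - theta) * (2 * M) ^+ n.+1 * m `^ theta =
    F * (m `^ theta * (2 * M)).
  by rewrite exprSr /F; ring.
rewrite -mulrA; apply: ler_wpM2l => //; apply: ler_wpM2l; first exact: powR_ge0.
rewrite mulrDl !mul1r lerD //; last by rewrite -[leLHS]mulr_natl.
by apply: le_trans M_ge; rewrite ler_nat heavy_card_le.
Qed.

End Decay.

(** * Null sets and limits at zero *)

Section OuterNull.
Variables (R : realType) (T : Type) (mu : {outer_measure set T -> \bar R}).

Lemma outer_null_subset (A B : set T) : A `<=` B -> mu B = 0%E -> mu A = 0%E.
Proof.
move=> AB B0; apply/eqP; rewrite eq_le outer_measure_ge0 andbT -B0.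
exact: le_outer_measure.
Qed.

Lemma outer_null_bigcup (I : countType) (F : I -> set T) :
  (forall i, mu (F i) = 0%E) -> mu (\bigcup_i F i) = 0%E.
Proof.
move=> F0; pose G n := if unpickle n is Some i then F i else set0.
apply: (@outer_null_subset _ (\bigcup_n G n)).
  by move=> z [i _ Fz]; exists (pickle i) => //; rewrite /G pickleK.
apply/eqP; rewrite eq_le outer_measure_ge0 andbT.
apply: le_trans (outer_measure_sigma_subadditive mu G) _.
rewrite eseries0 // => n _ _; rewrite /G; case: unpickle => //.
Qed.

Lemma outer_borel_cantelli (S : (set T)^nat) (K : R) : 0 <= K ->
  (forall n, (mu (S n) <= (K / (2 ^ n)%:R)%:E)%E) ->
  mu [set z | forall n0, exists2 n, (n0 <= n)%N & S n z] = 0%E.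
Proof.
move=> K0 SK; apply/eqP; rewrite eq_le outer_measure_ge0 andbT.
apply/lee_addgt0Pr => e e0; rewrite add0e.
have [n0 n0e] : exists n, K / 2 ^+ n <= e.
  exists (Num.truncn (K / e)).+1; rewrite ler_pdivrMr ?exprn_gt0 //.
  rewrite mulrC -ler_pdivrMr //; have /andP[_ h] := truncn_itv (divr_ge0 K0 (ltW e0)).
  by apply: le_trans (ltW h) _; rewrite -natrX ler_nat ltnW // ltn_expl.
apply: le_trans (_ : _ <= (K / 2 ^+ n0)%:E)%E _; last by rewrite lee_fin.
have sub : [set z | forall n0, exists2 n, (n0 <= n)%N & S n z] `<=`
    \bigcup_k S (k + n0.+1)%N.
  move=> z /(_ n0.+1)[n n0n Sz]; exists (n - n0.+1)%N => //.
  by rewrite subnK.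
apply: le_trans (le_outer_measure mu _ _ sub) _.
apply: le_trans (outer_measure_sigma_subadditive mu _) _.
apply: le_trans (lee_nneseries _ _) _.
- by move=> n _ _; exact: outer_measure_ge0.
- by move=> n _; exact: SK.
have := @cvg_geometric_eseries_half R K n0 => /cvg_lim => <- //.
Qed.

End OuterNull.

Section AtRight.
Variable R : realType.
Implicit Types (f : R -> \bar R) (l : \bar R).

Lemma at_right0_itv (e : R) : 0 < e -> (0 : R)^'+ [set r | 0 < r < e].
Proof.
move=> e0; near=> r => /=; apply/andP; split; near: r.
  exact: nbhs_right_gt.
exact: nbhs_right_lt.
Unshelve. all: by end_near. Qed.

Lemma limf_esup_at_right_le f l (e : R) : 0 < e ->
  (forall r, 0 < r < e -> (f r <= l)%E) -> (limf_esup f 0^'+ <= l)%E.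
Proof.
move=> e0 fl; apply: ge_ereal_inf.
exists (ereal_sup (f @` [set r | 0 < r < e])).
  by exists [set r | 0 < r < e] => //; exact: at_right0_itv.
by apply: ge_ereal_sup => _ [r re <-]; exact: fl.
Qed.

Lemma limf_einf_at_right_ge f l (e : R) : 0 < e ->
  (forall r, 0 < r < e -> (l <= f r)%E) -> (l <= limf_einf f 0^'+)%E.
Proof.
move=> e0 fl; rewrite /limf_einf leeNr; apply: (limf_esup_at_right_le e0) => r re.
by rewrite leeN2 fl.
Qed.

Lemma lt_limf_einf_at_right f l : (l < limf_einf f 0^'+)%E ->
  exists2 e : R, 0 < e & forall r, 0 < r < e -> (l < f r)%E.
Proof.
rewrite /limf_einf lteNr => /ereal_inf_lt [_ [V V0 <-]] h.
have [e /= e0 eV] : exists2 e : R, 0 < e & forall r, 0 < r < e -> V r.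
  move: V0; rewrite /at_right/= => -[e /= e0 eV]; exists e => // r /andP[r0 re].
  by apply: eV => //=; rewrite sub0r normrN gtr0_norm.
exists e => // r re; rewrite -lteN2; apply: le_lt_trans h.
by apply: ereal_sup_ubound; exists r => //; exact: eV.
Qed.

End AtRight.

(** * Almost sure dimension bound for points with holes *)

Section Dim.
Variables (R : realType) (d : nat) (mu : {outer_measure set 'rV[R]_d -> \bar R}).
Hypothesis mu_meas : is_measure mu.

Lemma ln_expN (b : R) n : 0 < b -> ln (b ^+ n) = n%:R * ln b.
Proof. by move=> b0; rewrite lnXn // mulr_natl. Qed.

(** A bound along the scales [N ^- j] passes to all radii, at the cost of a
    constant factor, which the strict inequality [s < s'] absorbs. *)
Lemma upper_local_dim_le (N j n1 : nat) (tau s s' : R) z : (1 < N)%N ->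
  0 < tau -> 0 <= s -> s < s' -> ln tau = - (s * ln N%:R) ->
  (forall n, (n1 <= n)%N -> tau ^+ n < mass mu N (j + n) (cell N (j + n) z)) ->
  (upper_local_dim mu z <= s'%:E)%E.
Proof.
move=> N1 t0 s0 ss' lnt mt.
have N0 : (0 : R) < N%:R by rewrite ltr0n; lia.
have NX0 n : (0 : R) < N%:R ^+ n by exact: exprn_gt0.
have N1r : (1 : R) <= N%:R by rewrite ler1n ltnW.
have lnN : (0 : R) < ln N%:R by rewrite ln_gt0 // ltr1n.
(* The ball of a cell of side [l] is contained in the ball of radius [E * l]
   centered at any point of the cell. *)
pose E : R := (3 * d + 2)%:R.
have E1 : 1 <= E by rewrite /E ler1n addn2.
have lnE : 0 <= ln E by rewrite ln_ge0.
pose G := ln E + ln N%:R.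
have sG : 0 <= s * G / (s' - s).
  by rewrite divr_ge0 ?subr_ge0 ?(ltW ss') // mulr_ge0 // addr_ge0 // ltW.
pose e := Num.min (E / N%:R ^+ (j + n1)) (Num.min 1 (expR (- (s * G / (s' - s))))).
have E0 : 0 < E by exact: lt_le_trans E1.
have e0 : 0 < e by rewrite /e !lt_min ltr01 expR_gt0 divr_gt0.
apply: (limf_esup_at_right_le e0) => r /andP[r0].
rewrite !lt_min => /and3P[rn1 r1 rG].
have exn : exists n, E / N%:R ^+ (j + n) <= r.
  exists (Num.truncn (E / r)).+1; rewrite ler_pdivrMr // mulrC -ler_pdivrMr //.
  have /andP[_ h] := truncn_itv (divr_ge0 (ltW E0) (ltW r0)).
  apply: le_trans (ltW h) _; rewrite -natrX ler_nat.
  apply: leq_trans (ltnW (ltn_expl _ N1)) _; by rewrite leq_exp2l // leq_addl.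
(* [N ^- (j + n)] is, up to the factor [E], the largest scale below [r]. *)
case: (ex_minnP exn) => n rn nmin.
have n1n : (n1 < n)%N.
  rewrite ltnNge; apply/negP => nn1; move: rn1; rewrite ltNge => /negP; apply.
  apply: le_trans rn; rewrite ler_pM2l //.
  by rewrite lef_pV2 ?posrE // ler_weXn2l // leq_add2l.
have n_gt0 : (0 < n)%N by exact: leq_ltn_trans n1n.
have rn' : r < E / N%:R ^+ (j + n.-1).
  rewrite ltNge; apply/negP => /nmin; by rewrite leqNgt ltn_predL n_gt0.
have mr : tau ^+ n < fine (mu (eball z r)).
  apply: lt_le_trans (mt n (ltnW n1n)) _.
  rewrite -lee_fin massE // fineK ?eball_fin_num //.
  apply: le_outer_measure; apply: eball_subset.
  have := corner_dist N1 (j + n) z; rewrite enorm_distC => h.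
  apply: le_trans (lerD h (lexx _)) _; apply: le_trans rn.
  by rewrite -mulrDl ler_wpM2r ?invr_ge0 ?(ltW (NX0 _)) // -natrD addnA -mulSn.
set x := fine _ in mr.
have x0 : 0 < x by apply: le_lt_trans mr; rewrite exprn_ge0 // ltW.
have lnr : ln r < 0 by rewrite ln_lt0 // r0.
have -> : mu (eball z r) = x%:E by rewrite fineK ?eball_fin_num.
rewrite lne_EFin // inver (lt_eqF lnr) -EFinM lee_fin ler_ndivrMr //.
have lx : - (n%:R * (s * ln N%:R)) <= ln x.
  rewrite -mulrN -lnt -ln_expN // ler_ln ?posrE ?exprn_gt0 //; exact: ltW.
have lr : ln r <= ln E - (n%:R - 1) * ln N%:R.
  have -> : ln E - (n%:R - 1) * ln N%:R = ln (E / N%:R ^+ n.-1).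
    rewrite ln_div ?posrE // ln_expN //.
    by congr (_ - _ * _); rewrite -subn1 natrB.
  have h : r <= E / N%:R ^+ n.-1.
    apply: le_trans (ltW rn') _; rewrite ler_pM2l //.
    by rewrite lef_pV2 ?posrE // ler_weXn2l // leq_addl.
  rewrite ler_ln ?posrE // divr_gt0 // (lt_le_trans _ E1) //.
have lG : ln r <= - (s * G / (s' - s)).
  by rewrite -[leRHS]expRK ler_ln ?posrE ?expR_gt0 // ltW.
have h1 : s * G <= (s' - s) * (- ln r).
  by rewrite [leRHS]mulrC -ler_pdivrMr ?subr_gt0 // lerNr.
have h2 : s * (n%:R * ln N%:R) <= s * (G - ln r).
  by apply: ler_wpM2l => //; rewrite /G; lra.
by apply: le_trans lx; rewrite mulrCA in h2 *; lra.
Qed.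


(** The term [d] compensates the loss in the exponent due to [theta]; half of the
    other term gives a factor [2 ^ (4 * hole_bound d)] that absorbs the constant of
    the count of heavy children. *)
Definition dim_const : nat := (d + 8 * hole_bound d)%N.

Lemma ae_upper_local_dim_le (k m : nat) : (0 < d)%N -> (k <= d)%N -> (0 < m)%N ->
  almost_all mu (fun z =>
    (forall eps : R, 0 < eps -> exists2 delta, 0 < delta &
       forall r, 0 < r < delta ->
         holes k mu ((1 - (2 ^ m)%:R^-1) / 2) r eps z) ->
    (upper_local_dim mu z <= (d%:R - k%:R + (dim_const.+1)%:R / m%:R)%:E)%E).
Proof.
move=> d0 kd m0; pose N := (2 ^ m)%N.
have N1 : (1 < N)%N by rewrite /N -{1}(expn0 2) ltn_exp2l.
have N0 : (0 : R) < N%:R by rewrite ltr0n ltnW.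
have mr : (0 : R) < m%:R by rewrite ltr0n.
have m1 : (1 : R) <= m%:R by rewrite ler1n.
have ln2 : (0 : R) < ln 2 by rewrite ln_gt0 // ltr1n.
pose M : R := (hole_bound d * N ^ (d - k))%:R.
have B0 : (0 < hole_bound d)%N by rewrite addn_gt0 [X in _ || X]expn_gt0 addn2 orbT.
have M1 : 1 <= M by rewrite ler1n muln_gt0 B0 expn_gt0 ltnW.
(* [theta] tends to 0 like [1 / log N]: then [N ^ theta] stays bounded, and so does
   the price of working with the powers [1 - theta]. *)
pose theta : R := (2 * m%:R)^-1.
have th0 : 0 < theta by rewrite invr_gt0 mulr_gt0.
have th1 : theta < 1 by rewrite invf_lt1 ?mulr_gt0 //; lra.
(* [eps `^ theta] is the inverse of the number of children of a cell. *)
pose eps : R := ((N ^ d)%:R^-1) ^+ (2 * m).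
have Nd0 : (0 : R) < (N ^ d)%:R by rewrite ltr0n expn_gt0 ltnW.
have eps0 : 0 < eps by rewrite exprn_gt0 // invr_gt0.
have eps_small : (N ^ d)%:R * eps `^ theta <= M.
  rewrite /eps -powR_mulrn ?invr_ge0 // -powRrM natrM /theta mulfV ?gt_eqF ?mulr_gt0 //.
  by rewrite powRr1 ?invr_ge0 // mulfV // gt_eqF.
pose w := ((d - k) * m + dim_const)%N.
(* [tau = N `^ (- s)] for [s = (d - k) + dim_const / m]. *)
pose tau : R := (2 ^+ w)^-1.
have tau0 : 0 < tau by rewrite invr_gt0 exprn_gt0.
have tauE : tau `^ (1 - theta) * (2 * M) <= 2^-1.
  have -> : tau = 2 `^ (- w%:R) by rewrite powRN powR_mulrn.
  rewrite -powRrM.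
  have wth : ((d - k) * m + 4 * hole_bound d)%:R <= w%:R * (1 - theta).
    have -> : w%:R * (1 - theta) = (w%:R : R) - (d - k)%:R / 2 - dim_const%:R / (2 * m%:R).
      by rewrite /theta /w natrD natrM; field; rewrite gt_eqF.
    have h1 : (d - k)%:R <= d%:R :> R by rewrite ler_nat leq_subr.
    have h2 : dim_const%:R / (2 * m%:R) <= dim_const%:R / 2 :> R.
      rewrite ler_wpM2l // lef_pV2 ?posrE ?mulr_gt0 //; lra.
    have h3 : dim_const%:R = d%:R + 8 * (hole_bound d)%:R :> R.
      by rewrite /dim_const natrD natrM.
    have hw : w%:R = (d - k)%:R * m%:R + (d%:R + 8 * (hole_bound d)%:R) :> R.
      by rewrite /w natrD natrM h3.
    rewrite hw natrD !natrM; rewrite h3 in h2 *; lra.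
  have : 2 `^ (- w%:R * (1 - theta)) <= (2 ^+ ((d - k) * m + 4 * hole_bound d)%N)^-1 :> R.
    rewrite -powR_mulrn // -powRN; apply: ler_powR; first by rewrite ler1n.
    by rewrite mulNr lerN2.
  move=> h; apply: le_trans (ler_wpM2r _ h) _.
    by rewrite mulr_ge0 // (le_trans ler01 M1).
  rewrite mulrC ler_pdivrMr ?exprn_gt0 // exprD /M natrM natrX /N natrX -exprM.
  rewrite mulrA mulrA [2 * _]mulrC.
  have -> : ((d - k) * m = m * (d - k))%N by rewrite mulnC.
  have h4 : (4 * hole_bound d)%:R <= 2 ^+ (4 * hole_bound d) :> R.
    by rewrite -natrX ler_nat ltnW // ltn_expl.
  have h5 : 0 <= 2 ^+ (m * (d - k)) :> R by rewrite exprn_ge0.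
  rewrite natrM in h4; set X := 2 ^+ (m * (d - k)) in h5 *; set Y := 2 ^+ (4 * _) in h4 *.
  nra.
pose K j a : R := mass mu N j a `^ theta.
pose A j0 := [set z | forall j, (j0 <= j)%N ->
  holes k mu ((1 - N%:R^-1) / 2) (N%:R ^+ j)^-1 eps z].
pose S j0 a n := thin N mu (A j0) (tau ^+ n) j0 n a.
pose bad (ja : nat * {ffun 'I_d -> int}) :=
  [set z | forall n0, exists2 n, (n0 <= n)%N & S ja.1 ja.2 n z].
have bad0 ja : mu (bad ja) = 0%E.
  case: ja => j0 a; apply: (@outer_borel_cantelli _ _ _ _ (K j0 a)).
    exact: powR_ge0.
  move=> n /=; have := @thin_le R d k N j0 mu mu_meas d0 kd N1 (A j0) eps (ltW eps0)
    (fun z j (h : A j0 z) => h j) M theta (tau ^+ n) th0 th1 (exprn_gt0 _ tau0)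
    (lexx _) eps_small j0 n a (leqnn _).
  move=> /le_trans; apply; rewrite lee_fin -/(K j0 a) mulrC.
  apply: ler_wpM2l; first exact: powR_ge0.
  have -> : (tau ^+ n) `^ (1 - theta) = (tau `^ (1 - theta)) ^+ n.
    by rewrite -powR_mulrn ?(ltW tau0) // -powRrM mulrC powRrM powR_mulrn ?powR_ge0.
  rewrite -exprMn natrX -exprVn lerXn2r ?nnegrE ?invr_ge0 //.
  by rewrite mulr_ge0 ?powR_ge0 // mulr_ge0 // (le_trans ler01 M1).
apply: (outer_null_subset _ (outer_null_bigcup bad0)) => z /= /not_implyP [hz dz].
have [delta delta0 hd] := hz eps eps0.
have [j0 j0P] : exists j0, forall j, (j0 <= j)%N -> (N%:R ^+ j)^-1 < delta.
  exists (Num.truncn delta^-1).+1 => j jj.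
  rewrite -[delta]invrK ltf_pV2 ?posrE ?exprn_gt0 ?invr_gt0 //.
  have dV : 0 <= delta^-1 by rewrite invr_ge0 ltW.
  have /andP[_ h] := truncn_itv dV; apply: lt_le_trans h _.
  by rewrite -natrX ler_nat (leq_trans jj) // ltnW // ltn_expl.
have Az : A j0 z.
  move=> j jj; apply: hd; rewrite j0P // invr_gt0 exprn_gt0 //.
exists (j0, cell N j0 z) => // n0; apply: contrapT => nn; apply: dz.
pose s : R := w%:R / m%:R.
apply: (@upper_local_dim_le N j0 n0 tau s) => //.
- by rewrite divr_ge0.
- rewrite /s /w natrD natrM mulrDl mulfK ?gt_eqF // natrB // ler_ltD //.
  by rewrite ltr_pM2r ?invr_gt0 // ltr_nat.
- rewrite lnV ?posrE ?exprn_gt0 // ln_expN // /N natrX ln_expN // /s.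
  by congr (- _); field; rewrite gt_eqF.
move=> n n0n; rewrite ltNge; apply/negP => h; apply: nn; exists n => //.
Qed.

End Dim.

(** * Porosity *)

Section Porosity.
Variables (R : realType) (d : nat) (mu : {outer_measure set 'rV[R]_d -> \bar R}).

Lemma le_limf_einf (f g : R -> \bar R) (F : set (set R)) :
  (forall r, (f r <= g r)%E) -> (limf_einf f F <= limf_einf g F)%E.
Proof.
move=> fg; rewrite !limf_einfE; apply: ge_ereal_sup => _ [V FV <-].
apply: (@le_trans _ _ (ereal_inf (g @` V))).
  apply: le_ereal_inf_tmp => _ [r Vr <-]; apply: le_trans (fg r).
  by apply: ereal_inf_lbound; exists r.
by apply: ereal_sup_ubound; exists V.
Qed.

Lemma por_scale_le k x r (eps eps' : R) : eps <= eps' ->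
  (por_scale k mu x r eps <= por_scale k mu x r eps')%E.
Proof.
move=> ee; apply: ereal_sup_le => _ [rho [rho0 [y [hy oy]]] <-].
exists rho => //; split => //; exists y; split => // i; have [h1 h2] := hy i.
by split => //; apply: le_trans h1 _; rewrite lee_wpmul2r // lee_fin.
Qed.

Lemma porosityE k x : porosity k mu x = ereal_inf
  [set limf_einf (fun r => por_scale k mu x r eps) 0^'+ |
    eps in [set eps | 0 < eps]].
Proof.
have -> : [set eps : R | 0 < eps] = [set` Interval (BRight 0) (BInfty R false)].
  by apply/seteqP; split => e /=; rewrite in_itv /= andbT.
apply: cvg_lim => //; apply: nondecreasing_at_right_cvge => //.
by move=> e e' _ _ ee; apply: le_limf_einf => r; exact: por_scale_le.
Qed.

Lemma lt_porosity_holes k x (q : R) : (q%:E < porosity k mu x)%E ->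
  forall eps : R, 0 < eps -> exists2 delta, 0 < delta & forall r, 0 < r < delta ->
    holes k mu q r eps x.
Proof.
rewrite porosityE => qp eps eps0.
have : (q%:E < limf_einf (fun r => por_scale k mu x r eps) 0^'+)%E.
  by apply: lt_le_trans qp _; apply: ereal_inf_lbound; exists eps.
move=> /lt_limf_einf_at_right [e e0 eP]; exists e => // r re.
have /ereal_sup_gt [_ [rho [rho0 [y [hy oy]]] <-]] := eP r re.
rewrite lte_fin => qrho; exists y; split => // i; have [h1 h2] := hy i.
have r0 : 0 <= r by case/andP: re => /ltW.
have qr : q * r <= rho * r by rewrite ler_wpM2r // ltW.
split; last by apply: le_trans h2; rewrite lerD2r.
apply: le_trans h1; apply: le_outer_measure; apply: eball_subset.
by rewrite subrr enorm0 add0r.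
Qed.

Hypothesis mu_meas : is_measure mu.

Lemma caratheodory_set1 (y : 'rV[R]_d) : mu.-caratheodory [set y].
Proof.
apply: (borel_caratheodory mu_meas); rewrite -[[set y]]setCK -setTD.
apply: sigma_algebraCD; apply: sub_sigma_algebra; rewrite /= openC.
exact/accessible_closed_set1/hausdorff_accessible/norm_hausdorff.
Qed.

(** Points are measurable, so that the masses of distinct ones add up. *)
Lemma atoms_mass_le (p : nat -> 'rV[R]_d) (c : R) n (B : set 'rV[R]_d) :
  injective p -> (forall i, (i < n)%N -> B (p i)) ->
  (forall i, (c%:E <= mu [set p i])%E) -> ((n%:R * c)%:E <= mu B)%E.
Proof.
move=> pinj + pc; elim: n B => [|n IH] B Bp.
  by rewrite mul0r outer_measure_ge0.
rewrite (caratheodory_set1 (p n) B) -natr1 addrC mulrDl mul1r EFinD leeD //.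
  apply: le_trans (pc n) _; apply: le_outer_measure => _ ->; split => //.
  exact: Bp.
apply: IH => i ni; split; first by apply: Bp; exact: ltnW.
by move=> pin; have ein := pinj _ _ pin; rewrite ein ltnn in ni.
Qed.

Lemma eball0 (y : 'rV[R]_d) : eball y 0 = [set y].
Proof.
apply/seteqP; split => [z|_ ->]; rewrite /eball /=; last by rewrite subrr enorm0.
move=> h; apply/eqP; rewrite -subr_eq0; apply/eqP/enorm_eq0/eqP.
by rewrite eq_le h enorm_ge0.
Qed.

(** Otherwise infinitely many points of the ball would have a mass greater than a
    fixed proportion of that of the ball. If the ball is null, its center will do. *)
Lemma light_point (x u : 'rV[R]_d) (r eps : R) : enorm u = 1 -> 0 < r -> 0 < eps ->
  exists2 t, 0 <= t <= r & (mu [set (x + t *: u)%R] <= eps%:E * mu (eball x r))%E.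
Proof.
move=> u1 r0 eps0; have fB := eball_fin_num mu_meas x r.
set b := fine (mu (eball x r)).
have bE : mu (eball x r) = b%:E by rewrite fineK.
have b0 : 0 <= b by rewrite fine_ge0 // outer_measure_ge0.
have [bz|bn0] := eqVneq b 0.
  exists 0; first by rewrite lexx ltW.
  apply: (@le_trans _ _ (mu (eball x r))); last by rewrite bE bz mule0.
  apply: le_outer_measure => _ ->.
  by rewrite scale0r addr0 /eball /= subrr enorm0 ltW.
have bgt0 : 0 < b by rewrite lt_neqAle eq_sym bn0.
apply: contrapT => nt.
pose p n := x + (r / n.+1%:R) *: u.
have tr n : 0 <= r / n.+1%:R <= r.
  by rewrite divr_ge0 ?(ltW r0) //= ler_pdivrMr // ler_peMr ?(ltW r0) // ler1n.
have pc n : ((eps * b)%:E <= mu [set p n])%E.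
  rewrite leNgt; apply/negP => h; apply: nt; exists (r / n.+1%:R) => //.
  by rewrite bE -EFinM ltW.
have u0 : u != 0.
  by apply/eqP => uz; move: u1; rewrite uz enorm0 => /esym/eqP; rewrite oner_eq0.
have pinj : injective p.
  move=> i j /addrI /eqP; rewrite -subr_eq0 -scalerBl scaler_eq0 (negPf u0) orbF.
  rewrite subr_eq0 => /eqP /(mulfI (lt0r_neq0 r0)) /GRing.invr_inj /eqP.
  by rewrite eqr_nat => /eqP [].
have pB n : eball x r (p n).
  by rewrite /eball /= addrC addKr enormZ u1 mulr1 ger0_norm; case/andP: (tr n).
have := @atoms_mass_le p (eps * b) (Num.truncn eps^-1).+1 _ pinj (fun n _ => pB n) pc.
rewrite bE lee_fin leNgt => /negP; apply.
rewrite mulrA -[ltLHS]mul1r ltr_pM2r // -ltr_pdivrMr // div1r.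
have V0 : 0 <= eps^-1 by rewrite invr_ge0 ltW.
by have /andP[_ h] := truncn_itv V0.
Qed.

(** Holes of radius zero exist at every scale: take a light point on each of [k]
    coordinate half-lines. *)
Lemma porosity_ge0 k x : (k <= d)%N -> (0 <= porosity k mu x)%E.
Proof.
move=> kd; rewrite porosityE; apply: le_ereal_inf_tmp => _ [eps /= eps0 <-].
apply: (limf_einf_at_right_ge ltr01) => r /andP[r0 _].
pose u (i : 'I_k) : 'rV[R]_d := delta_mx 0 (widen_ord kd i).
have uu i j : dotp (u i) (u j) = (i == j)%:R.
  rewrite /dotp (bigD1 (widen_ord kd i)) //= big1 ?addr0 => [|l li]; rewrite !mxE ?eqxx /=.
    by rewrite mul1r -!val_eqE.
  by rewrite (negPf li) mul0r.
have u1 i : enorm (u i) = 1 by rewrite /enorm uu eqxx sqrtr1.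
have /fin_all_exists2 [t t0 tP] := fun i => @light_point x (u i) r eps (u1 i) r0 eps0.
apply: ereal_sup_ubound; exists 0 => //; split => //.
exists (fun i => x + t i *: u i); split => [i|i j ji].
  rewrite mul0r eball0 add0r opprD addNKr enormN enormZ u1 mulr1 ger0_norm.
    by split => //; case/andP: (t0 i).
  by case/andP: (t0 i).
rewrite [x + _]addrC [x + _ - _]addrC addrK addKr dotpZl dotpZr uu.
by rewrite eq_sym (negPf ji) !mulr0.
Qed.

End Porosity.

(** * The dimension bound *)

Section Bound.
Variables (R : realType) (d k : nat) (c : R).

Lemma dim_bound_half p : ((2^-1)%:E <= p)%E -> dim_bound d k c p = (d%:R - k%:R)%:E.
Proof.
move=> hp; rewrite /dim_bound le0_lneNy; first by rewrite /= /inve mule0 adde0.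
case: p hp => [r| |] //=; last by rewrite gt0_muley ?lte_fin ?leNye.
by rewrite !lee_fin => ?; lra.
Qed.

Lemma dim_bound_fin r : 0 < r < 2^-1 ->
  dim_bound d k c r%:E = (d%:R - k%:R + c / (- ln (1 - 2 * r)))%:E.
Proof.
move=> /andP[r0 r2]; rewrite /dim_bound -EFinM -EFinB lne_EFin; last by lra.
by rewrite -EFinN inver oppr_eq0 lt_eqF ?ln_lt0 //; apply/andP; split; lra.
Qed.

Lemma dim_bound0 : 0 < c -> dim_bound d k c 0 = +oo%E.
Proof.
move=> c0; rewrite /dim_bound mule0 sube0 lne1 oppe0 inver eqxx.
by rewrite gt0_muley ?lte_fin // addey.
Qed.
End Bound.

Lemma pow2_sandwich (R : realType) (t : R) : 0 < t -> t < 2^-1 ->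
  exists2 m, (0 < m)%N & (2 ^ m.+1)%:R^-1 <= t < (2 ^ m)%:R^-1.
Proof.
move=> t0 t2.
have ex : exists n, (2 ^ n)%:R^-1 <= t.
  exists (Num.truncn t^-1).+1; rewrite -[t]invrK lef_pV2 ?posrE ?invr_gt0 ?ltr0n ?expn_gt0 //.
  rewrite invrK; have V0 : 0 <= t^-1 by rewrite invr_ge0 ltW.
  have /andP[_ h] := truncn_itv V0; apply: le_trans (ltW h) _.
  by rewrite ler_nat ltnW // ltn_expl.
case: (ex_minnP ex) => [[|[|m]]] tm mmin.
- by move: tm; rewrite expn0 invr1; lra.
- by move: tm; rewrite expn1; lra.
exists m.+1 => //; rewrite tm ltNge; apply/negP => /mmin.
by rewrite ltnn.
Qed.

Theorem theorem4p2 (R : realType) (d : nat) :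
  exists c : R, 0 < c /\
    forall (k : nat) (mu : {outer_measure set 'rV[R]_d -> \bar R}),
      (1 <= k <= d)%N -> is_measure mu ->
      almost_all mu (fun x =>
        (upper_local_dim mu x <= dim_bound d k c (porosity k mu x))%E).
Proof.
(* The factor 2 compares [m + 1] with [m]; the term [d] makes the bound exceed
   [d + e + 1], which is the crude bound of the dimension, when [p <= 1 / 4]. *)
set e := dim_const d; pose c : R := 2 * (d%:R + e.+1%:R).
have e0 : (0 : R) < e.+1%:R by rewrite ltr0n.
have dr0 : (0 : R) <= d%:R by [].
have c0 : 0 < c by rewrite /c; lra.
exists c; split=> // k mu /andP[k0 kd] mu_meas.
have d0 : (0 < d)%N by exact: leq_trans kd.
pose H j m x := forall eps : R, 0 < eps -> exists2 delta, 0 < delta &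
  forall r, 0 < r < delta -> @holes R d j mu ((1 - (2 ^ m)%:R^-1) / 2) r eps x.
pose bad j m := [set x | ~ (H j m x ->
  (upper_local_dim mu x <= (d%:R - j%:R + e.+1%:R / m%:R)%:E)%E)].
have bad0 n : mu (if n is m.+1 then bad k m.+1 else bad 0%N 1%N) = 0%E.
  by case: n => [|m]; apply: ae_upper_local_dim_le.
apply: (outer_null_subset _ (outer_null_bigcup bad0)) => x /= nx.
apply: contrapT => nbad; apply: nx.
have good m : (0 < m)%N -> H k m x ->
    (upper_local_dim mu x <= (d%:R - k%:R + e.+1%:R / m%:R)%:E)%E.
  by case: m => // m _; apply: contrapT => hb; apply: nbad; exists m.+1.
have crude : (upper_local_dim mu x <= (d%:R + e.+1%:R)%:E)%E.
  (* Without holes to find, the general estimate holds at almost every point. *)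
  have : H 0%N 1%N x ->
      (upper_local_dim mu x <= (d%:R - 0%:R + e.+1%:R / 1%:R)%:E)%E.
    by apply: contrapT => hb; apply: nbad; exists 0%N.
  rewrite subr0 divr1; apply=> eps eps0; exists 1 => // r _.
  by exists (fun=> 0); split => [[]|[]].
have hm m : (((1 - (2 ^ m)%:R^-1) / 2)%:E < porosity k mu x)%E -> H k m x.
  by move=> h; exact: lt_porosity_holes.
have := porosity_ge0 mu_meas x kd; move: hm; move: (porosity k mu x) => p hm p0.
have [p2|p2] := Order.TotalTheory.leP (2^-1)%:E p.
  rewrite dim_bound_half //; apply/lee_addgt0Pr => a a0.
  have [m m0 ma] : exists2 m, (0 < m)%N & e.+1%:R / m%:R <= a.
    exists (Num.truncn (e.+1%:R / a)).+1 => //; rewrite ler_pdivrMr // mulrC -ler_pdivrMr //.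
    by have /andP[_ /ltW] := truncn_itv (divr_ge0 (ltW e0) (ltW a0)).
  apply: le_trans (good m m0 _) _; last by rewrite -EFinD lee_fin lerD2l.
  apply: hm; apply: lt_le_trans p2; rewrite lte_fin.
  have : 0 < (2 ^ m)%:R^-1 :> R by rewrite invr_gt0 ltr0n expn_gt0.
  by lra.
case: p => [r| |] // in hm p0 p2 *.
rewrite lee_fin in p0; rewrite lte_fin in p2.
have [->|r0] := eqVneq r 0; first by rewrite dim_bound0 // leey.
have {}r0 : 0 < r by rewrite lt_neqAle eq_sym r0.
rewrite dim_bound_fin ?r0 //; set t := 1 - 2 * r.
have t0 : 0 < t by rewrite /t; lra.
have t1 : t < 1 by rewrite /t; lra.
have lt0 : 0 < - ln t by rewrite oppr_gt0 ln_lt0 // t0.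
have kd' : k%:R <= d%:R :> R by rewrite ler_nat.
have ln2 : ln 2 <= 1 :> R by rewrite (_ : 2 = 1 + 1) // le_ln1Dx //; lra.
have [t2|t2] := Order.TotalTheory.leP 2^-1 t.
  apply: le_trans crude _; rewrite lee_fin.
  suff : c <= c / (- ln t) by rewrite /c; lra.
  rewrite ler_pdivlMr // ler_piMr ?(ltW c0) //; apply: le_trans ln2.
  by rewrite lerNl -lnV ?posrE // ler_ln ?posrE ?invr_gt0.
have [m m0 /andP[tm1 tm2]] := pow2_sandwich t0 t2.
have mr : (0 : R) < m%:R by rewrite ltr0n.
apply: le_trans (good m m0 _) _.
  by apply: hm; rewrite lte_fin; move: tm2; rewrite /t; lra.
rewrite lee_fin lerD2l ler_pdivlMr // mulrAC ler_pdivrMr //.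
have lm : - ln t <= 2 * m%:R.
  have h : - ln t <= m.+1%:R * ln 2.
    rewrite -ln_expN // -natrX lerNl -lnV ?posrE ?ltr0n ?expn_gt0 //.
    by rewrite ler_ln ?posrE ?invr_gt0 ?ltr0n ?expn_gt0.
  apply: le_trans h _; apply: (@le_trans _ _ m.+1%:R); first by rewrite ler_piMr.
  by rewrite -natrM ler_nat mul2n -addnn -addn1 leq_add2l.
apply: (@le_trans _ _ (e.+1%:R * (2 * m%:R))); first by rewrite ler_pM2l.
by rewrite mulrA ler_pM2r // /c; lra.
Qed.
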